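(* Let $n\ge 4$ and let $T_n\in\mathfrak{T}_n$ be a triangular chain with length vector $(l_1,\dots,l_s)$. Let $TI$ be a bond incident degree index with edge weights $\theta_{a,b}$. Put \[\Lambda_{0}=2n\theta_{4,4}+2\theta_{2,3}+2\theta_{2,4}+2\theta_{3,4}-\theta_{3,5}-4\theta_{4,5},\] \[\Lambda_{1}=\theta_{2,5}-\theta_{2,4}+\theta_{3,3}-3\theta_{3,4}+\theta_{3,5}+3\theta_{4,4}-2\theta_{4,5},\] \[\Lambda_{2}=\theta_{3,5}-\theta_{3,4}+\theta_{4,4}-\theta_{4,5},\qquad \Lambda_{3}=2\theta_{3,4}+\theta_{3,5}-7\theta_{4,4}+4\theta_{4,5},\] \[\Lambda_{4}=2\theta_{3,5}-2\theta_{3,4}+3\theta_{4,4}-4\theta_{4,5}+\theta_{5,5},\qquad \Lambda_{5}=\theta_{4,4}-2\theta_{4,5}+\theta_{5,5}.\] Then \[TI(T_{n})= \begin{cases} \Lambda_{0}+\Lambda_{3} & \text{if } s=1,\\ \Lambda_{0}+\Lambda_{1}(\eta_{1}+\eta_{2})+\Lambda_{2}(\xi_{1}+\xi_{2})+2\Lambda_{3} & \text{if } s=2,\\ \Lambda_{0}+\Lambda_{1}(\eta_{1}+\eta_{s})+\Lambda_{2}(\xi_{1}+\xi_{s})+s\Lambda_{3}+\Lambda_{4}\sum_{i=2}^{s-1}\xi_{i}+\Lambda_{5}\sum_{i=2}^{s-1}\sigma_{i} & \text{if } s\ge 3. \end{cases}\]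
   Context: A triangular chain is a plane figure obtained by concatenating congruent equilateral triangles side to side so that every bounded (internal) region is one of these triangles, and whose characteristic graph (vertices = the triangles, two triangles adjacent iff they share a side) is a path; it is regarded as the simple graph whose vertices are the corner points of the triangles and whose edges are the sides of the triangles. A triangle is terminal if it shares a side with exactly one other triangle. A linear triangular chain is a triangular chain in which every vertex has degree at most 4. A segment of a triangular chain $T$ is a part of $T$ forming an induced subgraph which is a maximal linear triangular chain contained in $T$; a segment is terminal if it contains a terminal triangle. The length of a segment is its number of triangles. If $T$ has segments $S_1,\dots,S_s$, listed in order along the chain (so that for $s\ge 2$ the segments $S_1,S_s$ are the terminal ones), with lengths $l_i=$ length of $S_i$, then $(l_1,\dots,l_s)$ is the length vector of $T$. For $n\ge4$, $\mathfrak{T}_n$ is the set of triangular chains with $n$ triangles in which every vertex has degree at most 5. For $1\le i\le s$: $\eta_i=1$ if $l_i=3$ and $0$ otherwise; $\xi_i=1$ if $l_i=4$ and $0$ otherwise; $\sigma_i=1$ if $l_i=5$ and $0$ otherwise. A bond incident degree (BID) index is $TI(G)=\sum_{uv\in E(G)}\theta_{d_u,d_v}$, where $d_u$ is the degree of vertex $u$ and $\theta_{a,b}=\theta_{b,a}$ is a non-negative real number depending on $a,b$. *)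

(* Defs.v *)
(* Triangular chains are modelled on the triangular lattice. *)
From mathcomp Require Import all_boot all_order all_algebra.
Set Implicit Arguments. Unset Strict Implicit. Unset Printing Implicit Defensive.
Import Order.TTheory GRing.Theory Num.Theory.
Local Open Scope ring_scope.

(* Lattice points of the triangular lattice, in the basis (1, omega):
   (i, j) stands for i + j*omega, omega = exp(i pi/3). *)
Definition vtx := (int * int)%type.

(* A lattice triangle: ((i,j), true) is the "up" triangle with corners
   (i,j),(i+1,j),(i,j+1); ((i,j), false) is the "down" triangle with corners
   (i+1,j),(i,j+1),(i+1,j+1). *)
Definition tri := (vtx * bool)%type.

Definition corners (t : tri) : seq vtx :=
  let: ((i, j), b) := t in
  if b then [:: (i, j); (i + 1, j); (i, j + 1)]
  else [:: (i + 1, j); (i, j + 1); (i + 1, j + 1)].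

(* Sides, each lattice edge having a unique canonical representation. *)
Definition sides (t : tri) : seq (vtx * vtx) :=
  let: ((i, j), b) := t in
  if b then [:: ((i, j), (i + 1, j)); ((i, j), (i, j + 1)); ((i + 1, j), (i, j + 1))]
  else [:: ((i + 1, j), (i + 1, j + 1)); ((i, j + 1), (i + 1, j + 1));
           ((i + 1, j), (i, j + 1))].

Definition vertices (T : seq tri) : seq vtx := undup (flatten (map corners T)).
Definition edges (T : seq tri) : seq (vtx * vtx) := undup (flatten (map sides T)).
Definition deg (T : seq tri) (u : vtx) : nat :=
  count (fun e : vtx * vtx => (e.1 == u) || (e.2 == u)) (edges T).

Definition TI (R : nmodType) (theta : nat -> nat -> R) (T : seq tri) : R :=
  \sum_(e <- edges T) theta (deg T e.1) (deg T e.2).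

Definition share_side (t1 t2 : tri) : bool := has (fun e => e \in sides t2) (sides t1).

Definition tri0 : tri := ((0, 0), true).

Definition char_path (T : seq tri) : Prop :=
  forall i j, (i < j < size T)%N ->
    (share_side (nth tri0 T i) (nth tri0 T j) <-> j = i.+1).

(* Two lattice triangles lie in the same face of the plane graph when they
   are joined across a side that is not an edge of the graph. *)
Definition dual_adj (T : seq tri) : rel tri :=
  fun t t' => has (fun e => (e \in sides t') && (e \notin edges T)) (sides t).

Definition tri_norm (t : tri) : nat := (absz t.1.1 + absz t.1.2)%N.

(* Every bounded region is one of the triangles: every lattice triangle not in
   T lies in an unbounded face, i.e. it can be joined to arbitrarily far
   lattice triangles without crossing an edge of the graph. *)
Definition hole_free (T : seq tri) : Prop :=
  forall t, t \notin T -> forall N : nat,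
    exists p : seq tri, path (dual_adj T) t p /\ (N <= tri_norm (last t p))%N.

Definition tri_chain (T : seq tri) : Prop :=
  [/\ (0 < size T)%N, uniq T, char_path T & hole_free T].

Definition max_deg_le (k : nat) (T : seq tri) : Prop :=
  forall u, u \in vertices T -> (deg T u <= k)%N.

Definition linear_chain (T : seq tri) : Prop := tri_chain T /\ max_deg_le 4 T.

Definition slice (T : seq tri) (i j : nat) : seq tri := take (j - i).+1 (drop i T).

Definition induced_in (T S : seq tri) : Prop :=
  forall e, e \in edges T -> e.1 \in vertices S -> e.2 \in vertices S -> e \in edges S.

Definition seg_good (T : seq tri) (i j : nat) : Prop :=
  [/\ (i <= j < size T)%N, linear_chain (slice T i j) & induced_in T (slice T i j)].

(* Segment = maximal induced linear sub-chain (sub-chains of a chain whose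
   characteristic graph is a path are exactly the contiguous slices). *)
Definition is_segment (T : seq tri) (i j : nat) : Prop :=
  seg_good T i j /\
  forall i' j', seg_good T i' j' -> (i' <= i)%N -> (j <= j')%N -> i' = i /\ j' = j.

Definition length_vector (T : seq tri) (lv : seq nat) : Prop :=
  exists segs : seq (nat * nat),
    [/\ sorted ltn (map fst segs),
        (forall i j, (i, j) \in segs <-> is_segment T i j) &
        lv = map (fun p => (p.2 - p.1).+1) segs].

Section Lambdas.
Variables (R : pzRingType) (theta : nat -> nat -> R).
Definition Lambda0 (n : nat) : R :=
  (2 * n)%N%:R * theta 4 4 + 2%:R * theta 2 3 + 2%:R * theta 2 4 + 2%:R * theta 3 4
  - theta 3 5 - 4%:R * theta 4 5.
Definition Lambda1 : R :=
  theta 2 5 - theta 2 4 + theta 3 3 - 3%:R * theta 3 4 + theta 3 5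
  + 3%:R * theta 4 4 - 2%:R * theta 4 5.
Definition Lambda2 : R := theta 3 5 - theta 3 4 + theta 4 4 - theta 4 5.
Definition Lambda3 : R :=
  2%:R * theta 3 4 + theta 3 5 - 7%:R * theta 4 4 + 4%:R * theta 4 5.
Definition Lambda4 : R :=
  2%:R * theta 3 5 - 2%:R * theta 3 4 + 3%:R * theta 4 4 - 4%:R * theta 4 5
  + theta 5 5.
Definition Lambda5 : R := theta 4 4 - 2%:R * theta 4 5 + theta 5 5.
End Lambdas.

(* 0-indexed: eta lv k corresponds to eta_{k+1}. *)
Definition eta_ (R : pzRingType) (lv : seq nat) (k : nat) : R := (nth 0%N lv k == 3%N)%:R.
Definition xi_ (R : pzRingType) (lv : seq nat) (k : nat) : R := (nth 0%N lv k == 4%N)%:R.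
Definition sigma_ (R : pzRingType) (lv : seq nat) (k : nat) : R := (nth 0%N lv k == 5%N)%:R.

(* Main.v *)
(* Winding parities of closed walks vanish outside a chain without holes; this forces the
   triangles containing a given point to be consecutive, so every new triangle brings
   exactly one new vertex.  Numbering the vertices in order of appearance, the m-th
   triangle is {p m, m + 1, m + 2}, where the pivot p m is m, or m - 1 at a bend.  Hence
   the vertex k has degree 4 - x_k + x_(k+1) away from the ends, x being the indicator
   of the bends; since no two bends are adjacent, the weight of the edges added by a
   triangle is a linear combination of x_m, .., x_(m+3), x_m x_(m+2), x_(m+1) x_(m+3) and
   x_m x_(m+3).  Summation by shifting gives the Lambdas, and the segments are the
   intervals between consecutive bends, enlarged so that neighbours share two triangles. *)
Require Import Defs.
From mathcomp Require Import all_boot all_order all_algebra.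
From mathcomp Require Import zify ring.
Set Implicit Arguments. Unset Strict Implicit. Unset Printing Implicit Defensive.
Import Order.TTheory GRing.Theory Num.Theory.
Local Open Scope ring_scope.

(** * Lattice triangles and winding parity *)

(** Orients an edge as [sides] does, lower row first and then left to right, so that edges given by
    their ends compare with listed sides. *)
Definition edge_of (u w : vtx) : vtx * vtx :=
  if (u.2 < w.2) || (u.2 == w.2) && (u.1 < w.1) then (u, w) else (w, u).

Lemma edge_ofC u w : edge_of u w = edge_of w u.
Proof.
case: u w => [a b] [c d]; rewrite /edge_of /=.
case: ifP => h1; case: ifP => h2 //; last by congr (_, _); congr (_, _); lia.
by congr (_, _); congr (_, _); lia.
Qed.

Lemma edge_of_inj u w u' w' :
  edge_of u w = edge_of u' w' -> (u = u' /\ w = w') \/ (u = w' /\ w = u').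
Proof. by rewrite /edge_of; case: ifP => _; case: ifP => _ [-> ->]; auto. Qed.

Lemma edge_of_eq x y z s a b c d :
  let r := (y < s) || (y == s) && (x < z) in
  (edge_of (x, y) (z, s) == ((a, b), (c, d))) =
  r && [&& x == a, y == b, z == c & s == d] || ~~ r && [&& z == a, s == b, x == c & y == d].
Proof. by rewrite /edge_of /=; case: ifP => q; rewrite !xpair_eqE !andbA ?orbF. Qed.

Lemma uniq_corners t : uniq (corners t).
Proof.
by case: t => [[i j] []]; rewrite /= !inE !xpair_eqE; lia.
Qed.

Lemma size_corners t : size (corners t) = 3%N.
Proof. by case: t => [[i j] []]. Qed.

Lemma mem_corners i j b x y :
  ((x, y) \in corners ((i, j), b)) =
  if b then [|| (x == i) && (y == j), (x == i + 1) && (y == j) | (x == i) && (y == j + 1)]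
  else [|| (x == i + 1) && (y == j), (x == i) && (y == j + 1) | (x == i + 1) && (y == j + 1)].
Proof. by case: b; rewrite !inE !xpair_eqE. Qed.

Lemma edge_of_side t u w :
  u \in corners t -> w \in corners t -> u != w -> edge_of u w \in sides t.
Proof.
case: t u w => [[i j] b] [x y] [z s]; rewrite !mem_corners xpair_eqE /edge_of /=.
by case: b; case: ifP => h; rewrite !inE !xpair_eqE; lia.
Qed.

Lemma side_ends t e : e \in sides t ->
  [/\ e.1 \in corners t, e.2 \in corners t, e.1 != e.2 & edge_of e.1 e.2 = e].
Proof.
case: t => [[i j] []]; rewrite !inE => /or3P[] /eqP -> /=; split;
  rewrite ?inE ?eqxx ?orbT // ?xpair_eqE /edge_of /=; try lia.
all: by case: ifP => //; lia.
Qed.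

(* Whether the step from u to w crosses the ray going right from t. *)
Definition cross (t : tri) (u w : vtx) : bool :=
  let: ((i, j), b) := t in
  [&& u.2 == j, w.2 == j + 1 & i + 1 <= (if b then u.1 else w.1)]
  || [&& w.2 == j, u.2 == j + 1 & i + 1 <= (if b then w.1 else u.1)].

Lemma side_step t u w : edge_of u w \in sides t ->
  exists2 h : int * int, w = (u.1 + h.1, u.2 + h.2)
    & h \in [:: (1, 0); (-1, 0); (0, 1); (0, -1); (-1, 1); (1, -1)].
Proof.
move=> uw; exists (w.1 - u.1, w.2 - u.2).
  by rewrite [LHS]surjective_pairing /=; congr (_, _); lia.
case: t u w uw => [[i j] b] [x y] [z s]; rewrite /edge_of /=.
by case: ifP => _; case: b; rewrite !inE => /or3P[] /eqP[-> -> -> ->];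
  rewrite !xpair_eqE; lia.
Qed.

Lemma side_neighbour i j e t : e \in sides ((i, j), true) -> e \in sides t ->
  t != ((i, j), true) ->
  [\/ e = ((i, j), (i + 1, j)) /\ t = ((i, j - 1), false),
      e = ((i, j), (i, j + 1)) /\ t = ((i - 1, j), false) |
      e = ((i + 1, j), (i, j + 1)) /\ t = ((i, j), false)].
Proof.
case: t => [[i' j'] [|]]; rewrite !inE /= !xpair_eqE => /or3P[] /eqP ->;
  rewrite !xpair_eqE => h; try lia.
- by move=> _; constructor 1; split=> //; congr (_, _, _); lia.
- by move=> _; constructor 2; split=> //; congr (_, _, _); lia.
- by move=> _; constructor 3; split=> //; congr (_, _, _); lia.
Qed.

(** Moving the ray across [e] changes the steps it meets by the passages through [e], up to a
    coboundary, which closed walks do not see. *)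
Lemma cross_adjacent t t' e : e \in sides t -> e \in sides t' -> t != t' ->
  exists d : vtx -> bool, forall s u w, edge_of u w \in sides s ->
    cross t u w (+) cross t' u w = (edge_of u w == e) (+) (d u (+) d w).
Proof.
(* Triangles sharing a side have opposite orientations, so one of the two points up. *)
wlog: t t' / t.2 => [hw|].
  case tb: t.2; first by apply: hw.
  case t'b : t'.2.
    move=> et et' tt'; rewrite eq_sym in tt'; have [d dP] := hw _ _ t'b et' et tt'.
    by exists d => s u w us; rewrite addbC (dP s).
  move: e {hw}; case: t t' tb t'b => [[i j] []] // [[i' j'] []] // _ _ e.
  rewrite !inE => /or3P[] /eqP ->; rewrite !xpair_eqE; lia.
case: t => [[i j] []] // _ et et' tt'; rewrite eq_sym in tt'.
have := side_neighbour et et' tt'.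
case=> -[-> ->].
(* For a horizontal side the ray drops to the row below, sweeping over the lattice points to the
   right of that side; for the other two sides it stays in its row. *)
- exists (fun u => (u.2 == j) && (i + 1 <= u.1)).
  move=> s [x y] _ /side_step [h -> /=].
  rewrite !inE => /or4P[|||/or3P[]] /eqP->;
    by rewrite edge_of_eq /=; lia.
- exists (fun=> false).
  move=> s [x y] _ /side_step [h -> /=].
  rewrite !inE => /or4P[|||/or3P[]] /eqP->;
    by rewrite edge_of_eq /=; lia.
- exists (fun=> false).
  move=> s [x y] _ /side_step [h -> /=].
  rewrite !inE => /or4P[|||/or3P[]] /eqP->;
    by rewrite edge_of_eq /=; lia.
Qed.

(** At this distance the ray misses the ball of radius [M] or, starting to its left, cuts right
    through it; a crossing then only compares heights. *)
Lemma cross_far M t : (2 * M + 4 <= tri_norm t)%N ->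
  exists d : vtx -> bool, forall s u w, edge_of u w \in sides s ->
    (`|u.1| + `|u.2| <= M)%N -> (`|w.1| + `|w.2| <= M)%N ->
    cross t u w = d u (+) d w.
Proof.
case: t => [[i j] b]; rewrite /tri_norm /= => far.
exists (fun u => (i < 0) && (j + 1 <= u.2)).
move=> s [x y] _ /side_step [h -> /=].
by rewrite !inE => /or4P[|||/or3P[]] /eqP-> /=; case: b; lia.
Qed.

Lemma edgesP T e : reflect (exists2 t, t \in T & e \in sides t) (e \in edges T).
Proof. by rewrite mem_undup; apply: flatten_mapP. Qed.

Lemma verticesP T u : reflect (exists2 t, t \in T & u \in corners t) (u \in vertices T).
Proof. by rewrite mem_undup; apply: flatten_mapP. Qed.

Lemma vertices_bounded T :
  exists M, forall u, u \in vertices T -> (`|u.1| + `|u.2| <= M)%N.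
Proof.
elim: (vertices T) => [|v s [M hM]]; first by exists 0%N.
exists (`|v.1| + `|v.2| + M)%N => u; rewrite inE => /predU1P[-> | /hM h]; first exact: leq_addr.
exact: leq_trans h (leq_addl _ _).
Qed.

Fixpoint parity (f : vtx -> vtx -> bool) (u : vtx) (p : seq vtx) : bool :=
  if p is w :: p' then f u w (+) parity f w p' else false.

Lemma parity_add f g u p :
  parity (fun a b => f a b (+) g a b) u p = parity f u p (+) parity g u p.
Proof. by elim: p u => //= w p IH u; rewrite IH addbACA. Qed.

Lemma parity_coboundary (d : vtx -> bool) u p :
  parity (fun a b => d a (+) d b) u p = d u (+) d (last u p).
Proof.
by elim: p u => /= [u|w p IH u]; rewrite ?addbb // IH addbA -(addbA (d u)) addbb addbF.
Qed.

Lemma eq_in_parity (e : rel vtx) f g u p : path e u p ->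
  (forall a b, e a b -> f a b = g a b) -> parity f u p = parity g u p.
Proof. by move=> + fg; elim: p u => //= w p IH u /andP[/fg -> /IH ->]. Qed.

Lemma parity0 u p : parity (fun _ _ => false) u p = false.
Proof. by elim: p u => /=. Qed.

Definition joined (T : seq tri) : rel vtx := fun u w => edge_of u w \in edges T.

Lemma joined_vertices T u w : joined T u w -> (u \in vertices T) /\ (w \in vertices T).
Proof.
case/edgesP=> t tT /side_ends[+ + _ _].
rewrite /edge_of; case: ifP => /= _ h1 h2; split; apply/verticesP; by exists t.
Qed.

Lemma parity_cross T t t' e u p :
  e \in sides t -> e \in sides t' -> t != t' ->
  path (joined T) u p -> last u p = u ->
  parity (cross t) u p = parity (cross t') u p (+) parity (fun a b => edge_of a b == e) u p.
Proof.
move=> et et' tt' pth cl; have [d dP] := cross_adjacent et et' tt'.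
rewrite -parity_add.
rewrite (eq_in_parity (g := fun a b =>
  (cross t' a b (+) (edge_of a b == e)) (+) (d a (+) d b)) pth).
  by rewrite parity_add parity_coboundary cl addbb addbF.
move=> a b /edgesP[s _ /dP h]; rewrite -addbA -h; by rewrite addbCA addbb addbF.
Qed.

(* The winding parity of a closed walk is constant along dual paths that avoid the
   graph, and it vanishes far away, so it vanishes on every triangle outside T. *)
Lemma closed_walk_outside T t u p : hole_free T -> t \notin T ->
  path (joined T) u p -> last u p = u -> parity (cross t) u p = false.
Proof.
move=> hf tT pth cl; have [M hM] := vertices_bounded T.
have [q [tq far]] := hf t tT (2 * M + 4)%N.
have -> : parity (cross t) u p = parity (cross (last t q)) u p.
  elim: q t tq {far tT} => //= s q IH t /andP[/hasP[e et /andP[es eT]] /IH <-].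
  have [-> //|ts] := eqVneq t s.
  rewrite (parity_cross et es ts pth cl).
  rewrite [parity (fun a b => _ == e) u p](eq_in_parity (g := fun _ _ => false) pth).
    by rewrite parity0 addbF.
  by move=> a b ab; apply: contraNF eT => /eqP <-.
have [d dP] := cross_far far.
rewrite (eq_in_parity (g := fun a b => d a (+) d b) pth) ?parity_coboundary ?cl ?addbb //.
move=> a b ab; have [aT bT] := joined_vertices ab.
by case/edgesP: ab => s _ ab; apply: dP ab _ _; apply: hM.
Qed.

(** * Sub-chains of a chain *)

Lemma neighbour_across t e : e \in sides t -> exists2 t', e \in sides t' & t' != t.
Proof.
case: t => [[i j] []]; rewrite !inE => /or3P[] /eqP ->.
- by exists ((i, j - 1), false); rewrite ?inE !xpair_eqE; lia.
- by exists ((i - 1, j), false); rewrite ?inE !xpair_eqE; lia.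
- by exists ((i, j), false); rewrite ?inE !xpair_eqE; lia.
- by exists ((i + 1, j), true); rewrite ?inE !xpair_eqE; lia.
- by exists ((i, j + 1), true); rewrite ?inE !xpair_eqE; lia.
- by exists ((i, j), true); rewrite ?inE !xpair_eqE; lia.
Qed.

Lemma private_side t t' : t != t' -> exists2 e, e \in sides t & e \notin sides t'.
Proof.
move=> tt'; apply/hasP/hasPn => sub; move: tt'; apply/negP/negPn.
move: sub; case: t t' => [[i j] []] [[i' j'] []] sub; rewrite !xpair_eqE.
all: have s1 := sub _ (mem_head _ _); have s2 := sub _ (mem_last _ _).
all: by move: s1 s2; rewrite !inE !negbK !xpair_eqE; lia.
Qed.

Lemma share_side_sym : symmetric share_side.
Proof.
by move=> s t; apply/hasP/hasP => -[e h1 h2]; exists e.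
Qed.

Lemma edges_sub T T' : {subset T <= T'} -> {subset edges T <= edges T'}.
Proof. by move=> s e /edgesP[t /s tT et]; apply/edgesP; exists t. Qed.

Lemma dual_adj_sub T T' : {subset T' <= T} -> subrel (dual_adj T) (dual_adj T').
Proof.
move=> s t t' /hasP[e et /andP[et' eT]]; apply/hasP; exists e => //.
by rewrite et' /=; apply: contra eT; apply: edges_sub.
Qed.

(** Fewer edges allow more dual steps, so an escape path for [T] also serves [T']; a removed
    triangle first needs one step leaving [T]. *)
Lemma hole_free_sub T T' : hole_free T -> {subset T' <= T} ->
  (forall t, t \in T -> t \notin T' -> exists2 t', dual_adj T' t t' & t' \notin T) ->
  hole_free T'.
Proof.
move=> hf sub esc t tT' N.
have out s : s \notin T ->
    exists p, path (dual_adj T') s p /\ (N <= tri_norm (last s p))%N.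
  by move=> /hf /(_ N) [p [sp far]]; exists p; rewrite (sub_path (dual_adj_sub sub) sp).
case tT: (t \in T); last by apply: out; rewrite tT.
have [s ts /out[p [sp far]]] := esc t tT tT'.
by exists (s :: p); rewrite /= ts.
Qed.

Lemma char_path_share T i : char_path T -> (i.+1 < size T)%N ->
  share_side (nth tri0 T i) (nth tri0 T i.+1).
Proof. by move=> cp h; apply/(cp i i.+1) => //; rewrite ltnSn. Qed.

(** The first triangle has a side not shared with the second, hence with no later one. Once the
    triangle is removed, this side opens its place to a triangle outside the chain. *)
Lemma tri_chain_behead t T : (0 < size T)%N -> tri_chain (t :: T) -> tri_chain T.
Proof.
move=> T0 [_ /= /andP[tT uT] cp hf]; split=> //.
  by move=> i j ij; rewrite (cp i.+1 j.+1) ?ltnS //; split=> [[]|->].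
apply: (hole_free_sub hf) => [s sT|s]; first by rewrite inE sT orbT.
rewrite inE => /predU1P[-> _|->//].
have tn : t != nth tri0 T 0 by apply: contra tT => /eqP ->; rewrite mem_nth.
have [e et en] := private_side tn.
have eT s' : s' \in T -> e \notin sides s'.
  move=> s'T; rewrite -(nth_index tri0 s'T); apply/negP => es.
  have iT : (index s' T < size T)%N by rewrite index_mem.
  have [|shr _] := cp 0%N (index s' T).+1; first by rewrite ltnS.
  have i0 : index s' T = 0%N by apply/succn_inj/shr/hasP; exists e.
  by rewrite i0 (negPf en) in es.
have [t' et' t't] := neighbour_across et; exists t'.
  by apply/hasP; exists e => //; rewrite et' /=; apply/edgesP=> -[r /eT /negP].
by rewrite inE negb_or t't /=; apply/negP => /eT; rewrite et'.
Qed.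

Lemma tri_chain_rev T : tri_chain T -> tri_chain (rev T).
Proof.
move=> [T0 uT cp hf]; split; rewrite ?size_rev ?rev_uniq //.
  move=> i j ij; rewrite size_rev in ij; rewrite !nth_rev; try lia.
  rewrite share_side_sym cp; lia.
by apply: (hole_free_sub hf) => t; rewrite mem_rev // => ->.
Qed.

Lemma tri_chain_drop i T : (i < size T)%N -> tri_chain T -> tri_chain (drop i T).
Proof.
elim: i T => [|i IH] T; first by rewrite drop0.
case: T => // t T iT tc; apply: IH => //.
by apply: tri_chain_behead tc; apply: leq_ltn_trans (leq0n i) iT.
Qed.

Lemma tri_chain_take i T : (0 < i)%N -> tri_chain T -> tri_chain (take i T).
Proof.
move=> i0 tc; case: (leqP (size T) i) => [/take_oversize -> //|iT].
rewrite -[T]revK take_rev; apply/tri_chain_rev/tri_chain_drop/tri_chain_rev => //.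
by rewrite size_rev; lia.
Qed.

Lemma tri_chain_slice T i j : (i <= j < size T)%N -> tri_chain T -> tri_chain (slice T i j).
Proof.
by move=> ij tc; apply: tri_chain_take => //; apply: tri_chain_drop => //; lia.
Qed.

Lemma size_slice T i j : (i <= j < size T)%N -> size (slice T i j) = (j - i).+1.
Proof. by move=> ij; rewrite size_takel // size_drop; lia. Qed.

Lemma nth_slice T i j k : (k <= j - i)%N -> nth tri0 (slice T i j) k = nth tri0 T (i + k).
Proof. by move=> kj; rewrite nth_take ?nth_drop. Qed.

Lemma walk_along T i j u w : char_path T -> (i <= j < size T)%N ->
  u \in corners (nth tri0 T i) -> w \in corners (nth tri0 T j) ->
  exists2 p, path (joined T) u p & last u p = w.
Proof.
move=> cp; elim: j w => [|j IH] w ij ui wj; move: (ij); rewrite leq_eqVlt andb_orl => /orP[].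
1,3: case/andP=> /eqP ij' jT; rewrite -ij' in wj jT.
1,2: have [<-|uw] := eqVneq u w; first (by exists [::]).
1,2: exists [:: w]; rewrite //= andbT; apply/edgesP; exists (nth tri0 T i);
  rewrite ?mem_nth //; exact: edge_of_side.
- by [].
move=> ij'; have jT : (j.+1 < size T)%N by lia.
have /hasP[e ej ej'] := char_path_share cp jT.
have [cj _ _ _] := side_ends ej; have [cj' _ _ _] := side_ends ej'.
have [|p up lp] := IH e.1 _ ui cj; first by lia.
have [<-|cw] := eqVneq e.1 w; first by exists p.
exists (rcons p w); rewrite ?last_rcons // rcons_path up lp /=.
apply/edgesP; exists (nth tri0 T j.+1); first by rewrite mem_nth //; lia.
exact: edge_of_side.
Qed.

(* A corner of the last triangle that recurs earlier would close up a walk meeting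
   one of the two outer sides of that triangle exactly once and the other never; its
   winding parity would then differ on the triangles beyond these two sides, although
   both are outside T. *)
Lemma last_apex_new T k j v : tri_chain T -> size T = k.+2 ->
  v \in corners (nth tri0 T k.+1) -> v \notin corners (nth tri0 T k) ->
  (j <= k)%N -> v \notin corners (nth tri0 T j).
Proof.
move=> tc sT vt vs jk; apply/negP => vj.
have [_ _ cpP _] := tri_chain_take (ltn0Sn k) tc; case: tc => _ uT cp hf.
set t := nth tri0 T k.+1 in vt; set s := nth tri0 T k in vs.
have /hasP[e es et] : share_side s t by apply: char_path_share; rewrite ?sT.
have [as_ bs ab _] := side_ends es; have [at_ bt _ _] := side_ends et.
move: e.1 e.2 as_ bs at_ bt ab => a b as_ bs at_ bt ab {e es et}.
have va : v != a by apply: contraNneq vs => ->.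
have vb : v != b by apply: contraNneq vs => ->.
set P := take k.+1 T.
(* The sides at [v] belong to no earlier triangle: only triangle [k] shares a side with [t], and it
   lacks [v]. Beyond them lie triangles outside [T]. *)
have outer x : x \in corners t -> v != x ->
    (edge_of v x \notin edges P) /\
    exists t', [/\ edge_of v x \in sides t', t != t' & t' \notin T].
  move=> xt vx; have ex := edge_of_side vt xt vx.
  have no i : (i <= k)%N -> edge_of v x \notin sides (nth tri0 T i).
    move=> ik; apply/negP => exi.
    have [|shr _] := cp i k.+1; first by rewrite sT !ltnS ik /=.
    have ki : k = i by apply/succn_inj/shr/hasP; exists (edge_of v x).
    move: exi; rewrite -ki -/s => /side_ends[].
    by move: vs; rewrite /edge_of; case: ifP => _ /= /negPf vs; rewrite vs.
  split.
    apply/edgesP => -[r /(nthP tri0)[i]].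
    rewrite size_takel ?sT // => ik <-; rewrite nth_take // => h.
    by move: (no i ik); rewrite h.
  have [t' et' t't] := neighbour_across ex; exists t'; split; rewrite 1?eq_sym //.
  apply/(nthP tri0) => -[i]; rewrite sT ltnS leq_eqVlt => /predU1P[->|ik] it.
    by rewrite /t it eqxx in t't.
  by move: (no i ik); rewrite it et'.
have [eaP [ta [eta tta taT]]] := outer a at_ va.
have [ebP [tb [etb ttb tbT]]] := outer b bt vb.
have PT : {subset P <= T} by apply: mem_take.
have [p vp lp] : exists2 p, path (joined P) v p & last v p = a.
  have sP : size P = k.+1 by rewrite size_takel ?sT.
  by apply: (@walk_along P j k); rewrite ?sP ?ltnSn ?jk ?nth_take.
have walk : path (joined T) a (v :: p).
  rewrite /= /joined edge_ofC; apply/andP; split.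
    by apply/edgesP; exists t; rewrite ?mem_nth ?sT //; apply: edge_of_side.
  by apply: sub_path vp => x y; apply: edges_sub.
have free e : e \notin edges P -> parity (fun x y => edge_of x y == e) v p = false.
  move=> eP; rewrite (eq_in_parity (g := fun _ _ => false) vp) ?parity0 // => x y xy.
  by apply: contraNF eP => /eqP <-.
(* The closed walk uses the side from [a] to [v] once and the side from [v] to [b] never, so
   comparing [t] with [ta] and with [tb] gives two different parities for [t]. *)
have := parity_cross (edge_of_side vt at_ va) eta tta walk lp.
rewrite (parity_cross (edge_of_side vt bt vb) etb ttb walk lp).
rewrite (closed_walk_outside hf taT walk lp) (closed_walk_outside hf tbT walk lp) /=.
rewrite !free // !addbF edge_ofC eqxx.
case: eqP => // /edge_of_inj[[_ h]|[h _]]; last by rewrite h eqxx in vb.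
by rewrite h eqxx in ab.
Qed.

(** Going back from [c], at the first triangle lacking [x] the next one would have [x] as a new
    corner by [last_apex_new], against its presence in triangle [a]. *)
Lemma corner_interval T a b c x : tri_chain T -> (a <= b <= c)%N -> (c < size T)%N ->
  x \in corners (nth tri0 T a) -> x \in corners (nth tri0 T c) ->
  x \in corners (nth tri0 T b).
Proof.
move=> tc; elim: c => [|c IH] abc cT xa xc.
  by have -> : b = 0%N by lia.
have [bc|bc] := eqVneq b c.+1; first by rewrite bc.
case xc': (x \in corners (nth tri0 T c)); first by apply: IH => //; lia.
have tc' : tri_chain (take c.+2 T) by apply: tri_chain_take.
have := @last_apex_new _ c a x tc'; by rewrite size_takel // !nth_take; lia.
Qed.

(** * Numbering the vertices *)

Lemma corners_complete t x y : x \in corners t -> y \in corners t -> x != y ->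
  exists z, perm_eq (corners t) [:: x; y; z].
Proof.
move=> xt yt xy; have pt := perm_to_rem xt.
have yr : y \in rem x (corners t).
  by move: yt; rewrite (perm_mem pt) inE eq_sym (negPf xy).
have pr := perm_to_rem yr.
have := size_corners t; rewrite (perm_size pt) /= (perm_size pr) /=.
case: (rem y _) pr => [|z [|? ?]] //= pr _; exists z.
by rewrite (perm_trans pt) // perm_cons.
Qed.

Lemma corners_sub t t' : {subset corners t <= corners t'} -> t = t'.
Proof.
move=> sub; apply/eqP/negPn/negP => /private_side[e /side_ends[e1 e2 e12 <-]].
by rewrite edge_of_side ?sub.
Qed.

Lemma char_path_far T i : char_path T -> (i.+2 < size T)%N ->
  ~~ share_side (nth tri0 T i) (nth tri0 T i.+2).
Proof.
move=> cp iT; apply/negP => sh; have [|shr _] := cp i i.+2; first by rewrite leqnSn.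
by have := shr sh; lia.
Qed.

(** The side [A B] is taken by triangle [i], which shares no side with triangle [i.+2]; hence the
    next common side passes through [C]. *)
Lemma next_triangle T i A B C : char_path T -> (i.+2 < size T)%N ->
  perm_eq (corners (nth tri0 T i.+1)) [:: A; B; C] ->
  A \in corners (nth tri0 T i) -> B \in corners (nth tri0 T i) ->
  exists q x, (q = A \/ q = B) /\ perm_eq (corners (nth tri0 T i.+2)) [:: q; C; x].
Proof.
move=> cp iT pm Ai Bi; have /hasP[e es et] := char_path_share cp iT.
have [as_ bs ab _] := side_ends es; have [at_ bt _ _] := side_ends et.
move: e.1 e.2 as_ bs at_ bt ab => a b as_ bs at_ bt ab {e es et}.
have uq : uniq [:: A; B; C] by rewrite -(perm_uniq pm) uniq_corners.
have far := char_path_far cp iT.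
have nAB : A \in corners (nth tri0 T i.+2) -> B \in corners (nth tri0 T i.+2) -> False.
  move=> A2 B2; move/hasP: far; apply; exists (edge_of A B); apply: edge_of_side => //;
  by apply: contraTneq uq => ->; rewrite /= mem_head.
rewrite (perm_mem pm) !inE in as_; rewrite (perm_mem pm) !inE in bs.
have [aC|aC] := eqVneq a C.
  have bC : b != C by rewrite eq_sym -aC.
  have ba : b != a by rewrite eq_sym.
  have [x px] := corners_complete bt at_ ba.
  exists b, x; rewrite aC in px; split=> //; move: bs; rewrite (negPf bC) orbF.
  by case/orP=> /eqP; auto.
have [bC|bC] := eqVneq b C.
  have [x px] := corners_complete at_ bt ab.
  exists a, x; rewrite bC in px; split=> //; move: as_; rewrite (negPf aC) orbF.
  by case/orP=> /eqP; auto.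
case: nAB; move: as_ bs; rewrite (negPf aC) (negPf bC) !orbF;
  by case/orP=> /eqP ea /orP[] /eqP eb; rewrite ea eb ?eqxx in ab at_ bt *.
Qed.

(* [v m.+2] is the corner of the m-th triangle that the preceding one lacks; the
   m-th triangle keeps the pivot [v (p m.-1)] of its predecessor exactly when the
   chain bends. *)
Definition labels (T : seq tri) (k : nat) (v : nat -> vtx) (p : nat -> nat) : Prop :=
  (forall m, (m < k)%N ->
     perm_eq (corners (nth tri0 T m)) [:: v (p m); v m.+1; v m.+2]) /\
  (forall m, p m = m \/ (2 < m)%N /\ p m = p m.-1).

Lemma labels_exist T : tri_chain T -> (2 < size T)%N -> exists v p, labels T (size T) v p.
Proof.
move=> [_ uT cp _] T3.
suff ex k : (2 < k)%N -> (k <= size T)%N -> exists v p, labels T k v p by apply: ex.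
elim: k => // k IH; rewrite leq_eqVlt => /predU1P[<- _|k3 kT].
  have /hasP[e es et] := char_path_share cp (ltnW T3).
  have [as_ bs ab _] := side_ends es; have [at_ bt _ _] := side_ends et.
  move: e.1 e.2 as_ bs at_ bt ab => a b as_ bs at_ bt ab {e es et}.
  have [z pz] := corners_complete as_ bs ab.
  have [x px] := corners_complete at_ bt ab.
  have [q [y [qab py]]] := next_triangle cp T3 px as_ bs.
  (* The ends of the first common side are named so that the third triangle contains [b], the vertex
     2. This gives [p 2 = 2], so bends start at 3. *)
  wlog qb : a b as_ bs at_ bt ab pz px qab / q = b.
    move=> hw; case: (qab) => qe; last by apply: (hw a b).
    have swp (r s w : vtx) : perm_eq [:: r; s; w] [:: s; r; w].
      by apply/permP => f /=; rewrite addnCA.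
    apply: (hw b a) => //; [by rewrite eq_sym | | | by right].
      exact: perm_trans pz (swp _ _ _).
    exact: perm_trans px (swp _ _ _).
  exists (nth (0, 0) [:: z; a; b; x; y]), id; split; last by left.
  case=> [|[|[|//]]] _ //=; last by rewrite -qb.
  by rewrite (permPl pz); apply/permP => f /=; rewrite !addn0 addnA addnC.
have [|v [p [lT lp]]] := IH k3; first exact: ltnW.
case: k k3 kT IH lT => [|[|k]] // k3 kT _ lT.
have pk := lT k.+1 (ltnSn _).
have [||q [x [qab px]]] := next_triangle cp kT (A := v (p k.+1)) (B := v k.+2) (C := v k.+3) pk.
- rewrite (perm_mem (lT k (leqnSn _))) !inE.
  by case: (lp k.+1) => [->|[_ /= ->]]; rewrite eqxx ?orbT.
- by rewrite (perm_mem (lT k (leqnSn _))) !inE eqxx ?orbT.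
have [r [rk qr]] : exists r, (r = k.+2 \/ r = p k.+1) /\ q = v r.
  by case: qab => ->; [exists (p k.+1) | exists k.+2]; auto.
have ple m : (p m <= m)%N.
  elim: m => [|m IHm]; first by case: (lp 0%N) => [->|[]].
  by case: (lp m.+1) => [->|[_ ->]] //; apply: leqW.
have rk2 : (r <= k.+2)%N by case: rk => -> //; apply: leqW.
(* Beyond the new triangle [p] is reset to the identity, which keeps the second clause of [labels]
   true for every [m]. *)
exists (fun i => if i == k.+4 then x else v i),
  (fun m => if m == k.+2 then r else if (m > k.+2)%N then m else p m).
split=> m.
  rewrite ltnS leq_eqVlt => /predU1P[->|mk].
    have rk4 : (r == k.+4) = false by rewrite ltn_eqF // ltnS; apply: leqW.
    have k34 : (k.+3 == k.+4) = false by rewrite ltn_eqF.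
    by rewrite !eqxx rk4 k34 -qr.
  have h1 : (m == k.+2) = false := ltn_eqF mk.
  have h2 : (k.+2 < m)%N = false by rewrite ltnNge ltnW.
  have h3 : (p m == k.+4) = false.
    by rewrite ltn_eqF // (leq_ltn_trans (ple m)) // (leq_trans mk) // leqW.
  have h4 : (m.+1 == k.+4) = false by rewrite eqSS ltn_eqF // leqW.
  by rewrite h1 h2 h3 h4 !eqSS h1; apply: lT.
have [->|mk] := eqVneq m k.+2.
  by case: rk => ->; [left | right; split=> //=; rewrite ltn_eqF // ltnNge leqnSn].
case: ltnP => km; first by left.
case: (lp m) => [->|[m3 pm]]; [by left | right; split=> //].
have mk' : (m.-1 < k.+2)%N by rewrite (leq_ltn_trans (leq_pred m)) // ltn_neqAle mk.
by rewrite (ltn_eqF mk') ltnNge (ltnW mk').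
Qed.

(** Triangle [m] contributes the two edges at its new vertex; its third side is older, [(0, 1)]
    being the initial one. *)
Fixpoint label_pairs (p : nat -> nat) (n : nat) : seq (nat * nat) :=
  if n is m.+1 then (p m, m.+2) :: (m.+1, m.+2) :: label_pairs p m else [:: (0, 1)]%N.

(* The triangles m - 3, .., m then have a common vertex, of degree at least 5. *)
Definition bend (T : seq tri) (m : nat) : bool :=
  [&& (2 < m)%N, (m < size T)%N
    & has [in corners (nth tri0 T m)] (corners (nth tri0 T (m - 3)))].

Definition incident (k : nat) (ij : nat * nat) : bool := (ij.1 == k) || (ij.2 == k).

(** * Degree counts for an abstract pivot function *)

Section Pivots.
Variable p : nat -> nat.
Hypothesis pP : forall m, p m = m \/ (2 < m)%N /\ p m = p m.-1.

Lemma pivot_le m : (p m <= m)%N.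
Proof.
elim: m => [|m IH]; first by case: (pP 0) => [->|[]].
by case: (pP m.+1) => [->|[_ ->]] //; apply: leqW.
Qed.

Lemma pivot_ge2 m : (1 < m)%N -> (1 < p m)%N.
Proof.
elim: m => // m IH m1; case: (pP m.+1) => [->|[m2 ->]] //.
by apply: IH; rewrite -ltnS.
Qed.

Lemma pivot_idem m : p (p m) = p m.
Proof.
elim: m => [|m IH]; first by case: (pP 0) => [e|[]] //; rewrite !e.
by case: (pP m.+1) => [e|[_ /= ->]] //; rewrite !e.
Qed.

Lemma pivot_kept m : p m != m -> (2 < m)%N /\ p m = p m.-1.
Proof. by case: (pP m) => [->|//]; rewrite eqxx. Qed.

Lemma label_pairs_lt n ij : ij \in label_pairs p n -> (ij.1 < ij.2 < n.+2)%N.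
Proof.
elim: n => [|n IH]; first by rewrite inE => /eqP ->.
rewrite !inE => /or3P[/eqP->|/eqP->|/IH/andP[-> /leqW->]] //=.
  by rewrite !ltnS leqnn (leqW (pivot_le n)).
by rewrite !leqnn.
Qed.

Lemma uniq_label_pairs n : uniq (label_pairs p n).
Proof.
elim: n => //= n ->; rewrite andbT inE !negb_or xpair_eqE eqxx andbT.
have out i : (i, n.+2) \notin label_pairs p n.
  by apply/negP => /label_pairs_lt; rewrite ltnn andbF.
by rewrite !out !andbT ltn_eqF // ltnS pivot_le.
Qed.

Lemma label_pairs_in n ij : (0 < n)%N -> ij \in label_pairs p n ->
  exists2 m, (m < n)%N & (ij.1 \in [:: p m; m.+1; m.+2]) /\ (ij.2 \in [:: p m; m.+1; m.+2]).
Proof.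
elim: n => // n IH _; rewrite !inE => /or3P[/eqP->|/eqP->|ijn].
- by exists n; rewrite // !inE !eqxx ?orbT.
- by exists n; rewrite // !inE !eqxx ?orbT.
case: n IH ijn => [_|n IH /IH[] // m mn mem]; last by exists m => //; apply: ltnW.
rewrite inE => /eqP ->; exists 0%N => //.
by rewrite !inE; case: (pP 0) => [->|[]].
Qed.

Lemma label_pairs_tri n m : (m < n)%N ->
  [/\ (m.+1, m.+2) \in label_pairs p n, (p m, m.+2) \in label_pairs p n
    & (p m, m.+1) \in label_pairs p n].
Proof.
have up k : (m < k)%N -> {subset label_pairs p m.+1 <= label_pairs p k}.
  elim: k => // k IH; rewrite ltnS leq_eqVlt => /predU1P[<- //|/IH sub ij /sub ijk].
  by rewrite !inE ijk !orbT.
move=> mn; split; apply: (up _ mn); rewrite !inE ?eqxx ?orbT //.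
case: m mn {up} => [|m] _; first by case: (pP 0) => [->|[]].
by case: (pP m.+1) => [->|[_ /= ->]]; rewrite !inE !eqxx ?orbT.
Qed.

Lemma sum_label_pairs (V : nmodType) (F : nat -> nat -> V) n :
  \sum_(ij <- label_pairs p n) F ij.1 ij.2 =
  F 0%N 1%N + \sum_(0 <= m < n) (F m.+1 m.+2 + F (p m) m.+2).
Proof.
elim: n => [|n IH]; first by rewrite big_seq1 big_nil addr0.
by rewrite big_nat_recr //= !big_cons IH addrA addrC -addrA [_ + F n.+1 _]addrC.
Qed.

(** The terms count [k] as an end of the initial edge, as [m.+1] in [(m.+1, m.+2)], as the new
    vertex [m.+2] of two edges, and as a pivot. *)
Lemma count_incident k n : count (incident k) (label_pairs p n) =
  ((k < 2) + (0 < k <= n) + 2 * (1 < k <= n.+1)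
   + count (fun m => p m == k) (iota 0 n))%N.
Proof.
elim: n => [|n IH].
  by rewrite /incident /=; case: k => [|[|k]] //=; rewrite ltnNge.
rewrite -[in iota _ _]addn1 iotaD count_cat /= add0n IH /incident /=.
have := pivot_le n; lia.
Qed.

Lemma count_pivots_ge k n s : uniq s -> {in s, forall m, p m = k /\ (m < n)%N} ->
  (size s <= count (fun m => p m == k) (iota 0 n))%N.
Proof.
move=> us sP; rewrite -size_filter; apply: uniq_leq_size => // m /sP[pm mn].
by rewrite mem_filter pm eqxx mem_iota.
Qed.

(** Two edges come with the introduction of [k] and one leads to [k.+1]; each triangle with pivot
    [k] adds another. *)
Lemma incident_ge n k s : uniq s -> {in s, forall m, p m = k /\ (m < n)%N} ->
  (1 < k <= n)%N -> (3 + size s <= count (incident k) (label_pairs p n))%N.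
Proof.
by move=> us sP kn; have := count_pivots_ge us sP; rewrite count_incident; lia.
Qed.

Lemma incident_bend n m : (m < n)%N -> p m != m ->
  (5 <= count (incident (p m)) (label_pairs p n))%N.
Proof.
move=> mn pm; have [m2 _] := pivot_kept pm; have le := pivot_le m.
have ge := pivot_ge2 (ltnW m2).
(* By idempotence [p m] is also the pivot of triangle [p m], a second triangle besides [m]. *)
apply: (incident_ge (s := [:: p m; m])); rewrite /= ?inE ?pm //; last lia.
by move=> i; rewrite !inE => /orP[] /eqP ->; rewrite ?pivot_idem //; split=> //; lia.
Qed.

Lemma incident_two_bends n m : (m.+1 < n)%N -> p m != m -> p m.+1 != m.+1 ->
  (6 <= count (incident (p m)) (label_pairs p n))%N.
Proof.
move=> mn pm pm1; have [m2 _] := pivot_kept pm; have le := pivot_le m.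
have [_ /= e] := pivot_kept pm1; have ge := pivot_ge2 (ltnW m2).
apply: (incident_ge (s := [:: p m; m; m.+1])); last lia.
  by rewrite /= !inE; lia.
by move=> i; rewrite !inE => /or3P[] /eqP ->; rewrite ?pivot_idem ?e //; split=> //; lia.
Qed.

(** Only triangle [k], if it is no bend, and triangle [k.+1], if it is one, can have pivot [k]. The
    bound [2 < m] at bends keeps the subtraction from truncating. *)
Lemma count_pivots (x : nat -> bool) k n : (forall m, (m < n)%N -> p m = (m - x m)%N) ->
  (forall m, x m -> (2 < m)%N) ->
  count (fun m => p m == k) (iota 0 n) = ((k < n)%N && ~~ x k + (k.+1 < n)%N && x k.+1)%N.
Proof.
move=> + x2; elim: n => [//|n IH] px.
rewrite -[in iota _ _]addn1 iotaD count_cat /= add0n IH; last by move=> m mn; apply/px/ltnW.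
rewrite px // addn0.
have [kn|kn|->] := ltngtP k n.
- have [kn1|kn1] := eqVneq k.+1 n.
    have := x2 n; rewrite kn1; lia.
  have -> : (n - x n == k)%N = false by case: (x n); lia.
  by have -> : (k.+1 < n.+1)%N = (k.+1 < n)%N; lia.
- have -> : (n - x n == k)%N = false by case: (x n); lia.
  lia.
- have := x2 n; case: (x n); lia.
Qed.

End Pivots.

(** * Vertices and edges of a labelled chain *)

Section Labelled.
Variables (T : seq tri) (v : nat -> vtx) (p : nat -> nat).
Hypothesis tc : tri_chain T.
Hypothesis lab : labels T (size T) v p.
Let pP := lab.2.
Let n := size T.

Lemma labels_corner m i : (m < n)%N -> i \in [:: p m; m.+1; m.+2] ->
  v i \in corners (nth tri0 T m).
Proof.
move=> mn; rewrite (perm_mem (lab.1 _ mn)) !inE.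
by case/or3P=> /eqP ->; rewrite eqxx ?orbT.
Qed.

Lemma labels_old m i : (m.+1 < n)%N -> i \in [:: p m.+1; m.+2] ->
  v i \in corners (nth tri0 T m).
Proof.
move=> mn; rewrite !inE => im; apply: labels_corner; first exact: ltnW.
case/orP: im => /eqP ->; rewrite !inE ?eqxx ?orbT //.
by case: (pP m.+1) => [->|[_ /= ->]]; rewrite eqxx ?orbT.
Qed.

Lemma labels_new m : (m.+1 < n)%N -> v m.+3 \notin corners (nth tri0 T m).
Proof.
move=> mn; apply/negP => new.
have : nth tri0 T m.+1 = nth tri0 T m.
  apply: corners_sub => u; rewrite (perm_mem (lab.1 _ mn)) !inE.
  by case/or3P=> /eqP -> //; apply: labels_old; rewrite // !inE eqxx ?orbT.
case: tc => _ uT _ _ /eqP; rewrite nth_uniq //; last exact: ltnW.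
by rewrite gtn_eqF.
Qed.

(** Here the absence of holes enters: by [corner_interval] a repeated vertex would lie in the
    triangle just before the one that introduces it, against [labels_new]. *)
Lemma labels_inj i j : (0 < n)%N -> (i < n.+2)%N -> (j < n.+2)%N -> v i = v j -> i = j.
Proof.
move=> n0; wlog ij : i j / (i < j)%N.
  by move=> hw; case: (ltngtP i j) => // ij *; [|apply/esym]; apply: hw.
move=> _; case: j ij => [|[|[|m]]] // ij jn vij.
- have := uniq_corners (nth tri0 T 0); rewrite (perm_uniq (lab.1 _ n0)) /=.
  have -> : p 0 = 0%N by case: (pP 0) => [|[]].
  by case: i ij vij => // _ ->; rewrite mem_head.
- have := uniq_corners (nth tri0 T 0); rewrite (perm_uniq (lab.1 _ n0)) /=.
  have -> : p 0 = 0%N by case: (pP 0) => [|[]].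
  by case: i ij vij => [|[|//]] // _ ->; rewrite !inE eqxx /= ?orbT ?andbF.
rewrite !ltnS in jn.
have new := labels_new jn; case/negP: new.
have vm : v m.+3 \in corners (nth tri0 T m.+1) by apply: labels_corner; rewrite // !inE eqxx ?orbT.
(* Label [i] occurs in triangle [i.-2]; truncation sends the labels 0 and 1 to triangle 0. *)
apply: (corner_interval (a := i.-2) tc _ jn _ vm).
  by rewrite leqnSn andbT; case: i ij {vij} => [|[|i]].
rewrite -vij; apply: labels_corner.
  by apply: leq_ltn_trans jn; case: i ij {vij} => [|[|i]] //= /ltnW.
case: i ij {vij} => [|[|i]] //= _; rewrite !inE ?eqxx ?orbT //.
by case: (pP 0) => [->|[]].
Qed.

Lemma labels_cover u : u \in vertices T -> exists2 i, (i < n.+2)%N & u = v i.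
Proof.
case/verticesP=> t /(nthP tri0)[m mn <-]; rewrite (perm_mem (lab.1 _ mn)) !inE.
case/or3P=> /eqP ->; [exists (p m) | exists m.+1 | exists m.+2] => //.
  by apply: (leq_trans (pivot_le pP m)); apply/leqW/ltnW.
exact: leqW.
Qed.

Lemma labels_vertex i : (0 < n)%N -> (i < n.+2)%N -> v i \in vertices T.
Proof.
move=> n0 i_n; apply/verticesP; case: i i_n => [|[|i]] i_n.
- exists (nth tri0 T 0); first exact: mem_nth.
  by apply: labels_corner; rewrite // !inE; case: (pP 0) => [->|[]].
- exists (nth tri0 T 0); first exact: mem_nth.
  by apply: labels_corner; rewrite // !inE eqxx ?orbT.
exists (nth tri0 T i); first exact: mem_nth.
by apply: labels_corner; rewrite // !inE eqxx ?orbT.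
Qed.

Lemma edges_labels : (0 < n)%N ->
  perm_eq (edges T) [seq edge_of (v ij.1) (v ij.2) | ij <- label_pairs p n].
Proof.
move=> n0; apply: uniq_perm; first exact: undup_uniq.
  rewrite map_inj_in_uniq ?uniq_label_pairs // => -[i j] [i' j'].
  move=> /(label_pairs_lt pP) /= ij /(label_pairs_lt pP) /= ij' /edge_of_inj /=.
  by case=> -[/labels_inj e1 /labels_inj e2]; congr (_, _); lia.
move=> e; apply/edgesP/mapP => [[t /(nthP tri0)[m mn <-] et]|[[i j] ij ->]]; last first.
  have [m mn [im jm]] := label_pairs_in pP n0 ij.
  have := label_pairs_lt pP ij; rewrite /= in im jm * => ijn.
  exists (nth tri0 T m); first exact: mem_nth.
  apply: edge_of_side; [exact: labels_corner | exact: labels_corner |].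
  by apply: contraTneq ijn => /labels_inj e'; lia.
have [+ + + <-] := side_ends et; rewrite !(perm_mem (lab.1 _ mn)) !inE.
have [h1 h2 h3] := label_pairs_tri pP mn.
case/or3P=> /eqP -> /or3P[] /eqP ->; rewrite ?eqxx // => _;
  [exists (p m, m.+1) | exists (p m, m.+2) | exists (p m, m.+1) | exists (m.+1, m.+2)
  | exists (p m, m.+2) | exists (m.+1, m.+2)]; by rewrite //= edge_ofC.
Qed.
End Labelled.

(** * Degrees and bends *)

Section LabelledDegrees.
Variables (T : seq tri) (v : nat -> vtx) (p : nat -> nat).
Hypothesis tc : tri_chain T.
Hypothesis lab : labels T (size T) v p.
Let pP := lab.2.
Let n0 : (0 < size T)%N. Proof. by case: tc. Qed.

Lemma deg_labels k : (k < (size T).+2)%N ->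
  deg T (v k) = count (incident k) (label_pairs p (size T)).
Proof.
move=> kn; rewrite /deg (permP (edges_labels tc lab n0)) count_map.
apply: eq_in_count => -[i j] /(label_pairs_lt pP) /= /andP[ij jn].
have vE l : (l < (size T).+2)%N -> (v l == v k) = (l == k).
  by move=> ln; apply/eqP/eqP => [/(labels_inj tc lab n0 ln kn)|->].
rewrite /incident /edge_of /=; case: ifP => _ /=; rewrite !vE //; try exact: ltn_trans jn.
by rewrite orbC.
Qed.

Lemma TI_labels (R : nmodType) (theta : nat -> nat -> R) :
  (forall a b, theta a b = theta b a) ->
  let d k := count (incident k) (label_pairs p (size T)) in
  TI theta T = theta (d 0%N) (d 1%N)
    + \sum_(0 <= m < size T) (theta (d m.+1) (d m.+2) + theta (d (p m)) (d m.+2)).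
Proof.
move=> thC d; rewrite -(sum_label_pairs p (fun i j => theta (d i) (d j))).
rewrite /TI (perm_big _ (edges_labels tc lab n0)) big_map /=.
apply: eq_big_seq => -[i j] /(label_pairs_lt pP) /= /andP[ij jn].
have iN := ltn_trans ij jn.
by rewrite /edge_of; case: ifP => _ /=; rewrite !deg_labels.
Qed.

(** If [p m = m], the labels of triangle [m] are at least [m] and those of triangle [m - 3] are
    smaller. If the pivot is kept, tracing it back through the two triangles in between ends at a
    corner of triangle [m - 3]. *)
Lemma bend_labels m : (m < size T)%N -> bend T m = (p m != m).
Proof.
move=> mn; rewrite /bend mn /=; have [m2|m2] := ltnP 2 m; last first.
  by case: (pP m) => [->|[]]; rewrite ?eqxx // ltnNge m2.
case: m m2 mn => [|[|[|m]]] // _ mn; rewrite !subSS subn0.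
have mn' : (m < size T)%N by apply: ltn_trans mn; rewrite !ltnS leqW.
have le i := pivot_le pP i.
apply/hasP/idP => [[u um /= um3]|pm].
  apply: contraPneq um3 => pm; move: um; rewrite (perm_mem (lab.1 _ mn')) (perm_mem (lab.1 _ mn)).
  rewrite pm !inE => um um3.
  have [i im ui] : exists2 i, (i <= m.+2)%N & u = v i.
    case/or3P: um => /eqP ->; [exists (p m) | exists m.+1 | exists m.+2] => //.
    by apply: leq_trans (le m) _; rewrite leqW.
  have [j jm uj] : exists2 j, (m.+3 <= j < (size T).+2)%N & u = v j.
    case/or3P: um3 => /eqP ->; [exists m.+3 | exists m.+4 | exists m.+4.+1] => //;
      by clear -mn; lia.
  have ij : i = j by apply: (labels_inj tc lab n0); rewrite -?ui -?uj //; lia.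
  by move: im jm; rewrite ij; lia.
exists (v (p m.+3)) => /=; last by rewrite (perm_mem (lab.1 _ mn)) mem_head.
rewrite (perm_mem (lab.1 _ mn')) !inE.
case: (pP m.+3) pm => [->|[_ /= -> _]]; first by rewrite eqxx.
case: (pP m.+2) => [->|[_ /= ->]]; first by rewrite eqxx !orbT.
by case: (pP m.+1) => [->|[_ /= ->]]; rewrite eqxx ?orbT.
Qed.

End LabelledDegrees.

(** Settles the chains of at most two triangles, too short for [labels_exist]: their degrees are at
    most 4. *)
Lemma deg_le_2size T u : (deg T u <= 2 * size T)%N.
Proof.
rewrite /deg /edges; set a : pred (vtx * vtx) := fun e => _.
apply: (@leq_trans (count a (flatten (map sides T)))).
  by apply: leq_count_subseq; apply: undup_subseq.
elim: T => // t T IH; rewrite map_cons /flatten /= -/(flatten _) count_cat mulnS.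
apply: (leq_add _ IH) => {IH}; rewrite /a => {a}; case: t u => [[i j] b] [x y].
by case: b; rewrite /= !xpair_eqE; lia.
Qed.

(** The pivot at a bend has degree at least 5; without bends every pivot is [p m = m], so each
    vertex is the pivot of at most one triangle. *)
Lemma max_deg4_bend T : tri_chain T -> max_deg_le 4 T <-> forall m, ~~ bend T m.
Proof.
move=> tc; have n0 : (0 < size T)%N by case: tc.
have [n2|n2] := ltnP 2 (size T); last first.
  split=> _; last by move=> u _; apply: leq_trans (deg_le_2size T u) _; lia.
  by move=> m; rewrite /bend; apply/negP => /and3P[m2 mn _]; lia.
have [v [p lab]] := labels_exist tc n2; have pP := lab.2.
split=> [mx m|nb u /(labels_cover lab)[k kn ->]].
  apply/negP => bm; have mn : (m < size T)%N by case/and3P: bm.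
  rewrite (bend_labels tc lab mn) in bm.
  have := incident_bend pP mn bm.
  have pn : (p m < (size T).+2)%N by have := pivot_le pP m; lia.
  by rewrite -(deg_labels tc lab pn) leqNgt ltnS mx ?(labels_vertex lab).
rewrite (deg_labels tc lab kn) (count_incident pP).
rewrite (count_pivots (x := fun=> false)) //.
  by rewrite andbF; lia.
move=> m mn; rewrite subn0; apply/eqP/negPn.
by rewrite -(bend_labels tc lab mn).
Qed.

(** Two bends in a row keep one pivot for three triangles, which forces degree at least 6. *)
Lemma max_deg5_bend T m : tri_chain T -> max_deg_le 5 T -> bend T m -> ~~ bend T m.+1.
Proof.
move=> tc mx bm; apply/negP => bm1; have n0 : (0 < size T)%N by case: tc.
have m1n : (m.+1 < size T)%N by case/and3P: bm1.
have m2 : (2 < m)%N by case/and3P: bm.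
have n2 : (2 < size T)%N by lia.
have [v [p lab]] := labels_exist tc n2; have pP := lab.2.
rewrite (bend_labels tc lab (ltnW m1n)) in bm; rewrite (bend_labels tc lab m1n) in bm1.
have := incident_two_bends pP m1n bm bm1.
have pn : (p m < (size T).+2)%N by have := pivot_le pP m; lia.
by rewrite -(deg_labels tc lab pn) leqNgt ltnS mx ?(labels_vertex lab).
Qed.

(** * Bends and segments *)

Lemma bend_slice T i j m : (i <= j < size T)%N ->
  bend (slice T i j) m = [&& (2 < m)%N, (i + m <= j)%N & bend T (i + m)].
Proof.
move=> ij; rewrite /bend size_slice //.
have [m2|//] := ltnP 2 m; have [imj|imj] := leqP (i + m) j; last first.
  by rewrite ltnS (_ : (m <= j - i)%N = false) //; lia.
rewrite !nth_slice; try lia.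
have -> : (i + m - 3 = i + (m - 3))%N by lia.
have -> : (m < (j - i).+1)%N by lia.
have -> : (2 < i + m)%N by lia.
by have -> : (i + m < size T)%N by lia.
Qed.

(** By [corner_interval], both ends of the edge lie in the triangle of the slice nearest to the
    triangle [k] carrying it. *)
Lemma slice_induced T i j : tri_chain T -> (i <= j < size T)%N -> induced_in T (slice T i j).
Proof.
move=> tc ij e /edgesP[t /(nthP tri0)[k kn <-] ek].
have [e1 e2 e12 eE] := side_ends ek.
have inS l : (i <= l <= j)%N -> nth tri0 T l \in slice T i j.
  move=> il; have lE : (i + (l - i) = l)%N by lia.
  have lj : (l - i <= j - i)%N by lia.
  by rewrite -lE -(nth_slice _ lj) mem_nth // size_slice.
have clamp u : u \in corners (nth tri0 T k) -> u \in vertices (slice T i j) ->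
    u \in corners (nth tri0 T (maxn i (minn j k))).
  move=> uk /verticesP[s /(nthP tri0)[l]]; rewrite size_slice // => lj <-.
  rewrite nth_slice // => ul.
  have [kl|lk] := leqP k (i + l).
    by apply: (corner_interval tc _ _ uk ul); lia.
  by apply: (corner_interval tc _ kn ul uk); lia.
move=> /(clamp _ e1) c1 /(clamp _ e2) c2; apply/edgesP.
exists (nth tri0 T (maxn i (minn j k))); first by apply: inS; lia.
by rewrite -eE edge_of_side.
Qed.

(** Inducedness is automatic; what remains is that no bend has all its triangles [m - 3], ..., [m]
    in the slice. *)
Lemma seg_goodP T i j : tri_chain T ->
  seg_good T i j <-> (i <= j < size T)%N /\ forall m, (i + 3 <= m <= j)%N -> ~~ bend T m.
Proof.
move=> tc; split=> [[ij [tcS /(max_deg4_bend tcS) nb] _]|[ij nb]].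
  split=> // m im; have := nb (m - i)%N; rewrite bend_slice //.
  have -> : (i + (m - i) = m)%N by lia.
  have -> : (2 < m - i)%N by lia.
  by have -> : (m <= j)%N by lia.
have tcS := tri_chain_slice ij tc.
split=> //; last exact: slice_induced.
split=> //; apply/(max_deg4_bend tcS) => m; rewrite bend_slice //.
by apply/and3P => -[m2 mj]; apply/negP/nb; lia.
Qed.

(** A bend [m] closes a segment at [m.-1]; the next one opens at [m - 2], the first start that
    leaves out triangle [m - 3]. *)
Fixpoint segments_of (a : nat) (bends : seq nat) (n : nat) : seq (nat * nat) :=
  if bends is m :: bends' then (a, m.-1) :: segments_of (m - 2) bends' n
  else [:: (a, n.-1)].

(** Maximality one triangle at a time: an end that is not extreme is blocked because one more
    triangle would complete the bend [i.+2] on the left, or [j.+1] on the right. *)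
Definition segment_between (a : nat) (bends : seq nat) (n i j : nat) : Prop :=
  [/\ (i <= j < n)%N, (forall m, m \in bends -> (i + 3 <= m <= j)%N -> False),
      i = a \/ (i.+2 \in bends /\ (i.+2 <= j)%N)
    & j = n.-1 \/ (j.+1 \in bends /\ (i.+2 <= j)%N)].

Definition gap2 : rel nat := fun a b => (a.+1 < b)%N.

Lemma gap2_trans : transitive gap2.
Proof. by move=> a b c; rewrite /gap2; lia. Qed.

(** With first bend [m], a segment starting at [a] must stop at [m.-1], and any other starts at
    [m - 2] or later. *)
Lemma segments_ofP a bends n i j : (a < n)%N -> sorted gap2 bends ->
  (forall m, m \in bends -> (a + 3 <= m < n)%N) ->
  (i, j) \in segments_of a bends n <-> segment_between a bends n i j.
Proof.
elim: bends a => [|m B IH] a an srt bd.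
  rewrite inE; split=> [/eqP[-> ->]|[ij _ [->|[]//] [->|[]//]]]; last exact: eqxx.
  by split=> //; [lia | left | left].
have mB : (a + 3 <= m < n)%N by apply: bd; rewrite mem_head.
have gB m' : m' \in B -> (m + 2 <= m' < n)%N.
  move=> m'B; have := order_path_min gap2_trans srt => /allP /(_ _ m'B).
  by have := bd m' ltac:(by rewrite inE m'B orbT); rewrite /gap2; lia.
have {}IH : (i, j) \in segments_of (m - 2) B n <-> segment_between (m - 2) B n i j.
  apply: IH; [lia | exact: path_sorted srt | move=> m' /gB; lia].
rewrite inE; split=> [/predU1P[[-> ->]|/IH[ij nb il jr]]|[ij nb il jr]].
- split; [lia | | by left |].
    by move=> m'; rewrite inE => /predU1P[->|/gB]; lia.
  by right; rewrite prednK ?mem_head; [split=> //; lia | lia].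
- have im : (m - 2 <= i)%N by case: il => [->|[/gB]]; lia.
  split=> //.
  + by move=> m'; rewrite inE => /predU1P[->|/nb //]; lia.
  + right; case: il => [im2|[iB ilj]]; last by rewrite inE iB orbT.
    have -> : i.+2 = m by lia.
    by rewrite mem_head; split=> //; case: jr => [->|[/gB]]; lia.
  + by case: jr => [->|[jB ilj]]; [left | right; rewrite inE jB orbT].
apply/predU1P; case: il => [ia|[]].
  left; congr (_, _) => //; have nm := nb m (mem_head _ _).
  by case: jr => [jn|[]]; [lia | rewrite inE => /predU1P[|/gB]; lia].
rewrite inE => iB ilj; right; apply/IH; split=> //.
- by move=> m' m'B; apply: nb; rewrite inE m'B orbT.
- by case/predU1P: iB => [im|iB]; [left; lia | right].
have im : (m <= i.+2)%N by case/predU1P: iB => [->|/gB]; lia.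
case: jr => [->|[]]; [by left|rewrite inE => jB _; right; split=> //].
by case/predU1P: jB; [lia|].
Qed.

(** Were the bend blocking an end missing, a triangle could be added there; conversely a good
    enlargement would contain that bend. *)
Lemma is_segmentP T bends i j : tri_chain T -> (forall m, (m \in bends) = bend T m) ->
  is_segment T i j <-> segment_between 0 bends (size T) i j.
Proof.
move=> tc bdE; have bd m : bend T m -> (2 < m < size T)%N.
  by case/and3P=> -> ->.
split=> [[/(seg_goodP _ _ tc)[ij nb] mx]|[ij nb il jr]].
  split=> //.
  - by move=> m; rewrite bdE => bm /nb; rewrite bm.
  - case: i ij nb mx => [|i] ij nb mx; first by left.
    right; rewrite bdE; apply/andP/negPn/negP => nbi.
    have gd : seg_good T i j.
      apply/(seg_goodP _ _ tc); split; first by lia.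
      move=> m im; have [->|mi] := eqVneq m i.+3.
        by move: nbi; rewrite negb_and => /orP[//|]; lia.
      by apply: nb; lia.
    by have [] := mx _ _ gd (leqnSn i) (leqnn j); lia.
  have [jn|jn] := eqVneq j (size T).-1; first by left.
  right; rewrite bdE; apply/andP/negPn/negP => nbj.
  have gd : seg_good T i j.+1.
    apply/(seg_goodP _ _ tc); split; first by lia.
    move=> m im; have [mj|mj] := eqVneq m j.+1; last by apply: nb; lia.
    by rewrite mj; move: nbj; rewrite negb_and => /orP[//|]; lia.
  by have [] := mx _ _ gd (leqnn i) (leqnSn j); lia.
split.
  apply/(seg_goodP _ _ tc); split=> // m im; apply/negP => bm; apply: (nb m) => //.
  by rewrite bdE.
move=> i' j' /(seg_goodP _ _ tc)[ij' nb'] ii jj; split.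
  case: il => [i0|[]]; first by lia.
  by rewrite bdE => bi ilj; have := nb' i.+2; rewrite bi; lia.
case: jr => [j0|[]]; first by lia.
by rewrite bdE => bj ilj; have := nb' j.+1; rewrite bj; lia.
Qed.

Definition lengths (a : nat) (bends : seq nat) (n : nat) : seq nat :=
  map (fun q : nat * nat => (q.2 - q.1).+1) (segments_of a bends n).

Lemma size_lengths a bends n : size (lengths a bends n) = (size bends).+1.
Proof.
by rewrite size_map; elim: bends a => //= m B IH a; rewrite IH.
Qed.

Lemma segments_of_sorted a bends n : sorted gap2 bends ->
  (forall m, m \in bends -> (a + 3 <= m)%N) -> sorted ltn (map fst (segments_of a bends n)).
Proof.
have fstE B b : map fst (segments_of b B n) = b :: [seq m - 2 | m <- B]%N.
  by elim: B b => //= m B IH b; rewrite IH.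
rewrite fstE; case: bends => //= m B srt bd; apply/andP; split.
  by have := bd m (mem_head _ _); lia.
have {bd} : (2 < m)%N by have := bd m (mem_head _ _); lia.
elim: B m srt => //= m' B IH m /andP[mm' srt] m2; move: mm'; rewrite /gap2 => mm'.
by rewrite IH // ?andbT; lia.
Qed.

Lemma last_length m bends n : path gap2 m bends -> (2 < m)%N ->
  nth 0%N (lengths (m - 2) bends n) (size bends) = (n.-1 - (last m bends - 2)).+1.
Proof.
elim: bends m => //= m' B IH m /andP[mm' srt] m2; apply: IH => //.
by move: mm'; rewrite /gap2; lia.
Qed.

(** The segment between consecutive bends [a] and [b] has length [b - a + 2]. As bends are at least
    2 apart, for [d] equal to 2 or 3 a bend at [a + d] is the next one. The sum leaves out the
    terminal segment. *)
Lemma sum_lengths (R : pzSemiRingType) d m bends n : path gap2 m bends -> (2 < m)%N ->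
  (1 < d < 4)%N ->
  \sum_(0 <= k < size bends) (nth 0%N (lengths (m - 2) bends n) k == d.+2)%:R =
  \sum_(a <- m :: bends) ((a + d)%N \in m :: bends)%:R :> R.
Proof.
move=> + + d4; elim: bends m => [|m' B IH] m.
  by rewrite big_nil big_seq1 inE; case: eqP => //; lia.
move=> /= /andP[mm' srt] m2; rewrite /gap2 in mm'.
have gB a : a \in B -> (m'.+1 < a)%N.
  by have := order_path_min gap2_trans srt => /allP /[apply].
rewrite [LHS]big_nat_recl // [RHS]big_cons; congr (_ + _).
  congr (_%:R); congr nat_of_bool; rewrite !inE /=.
  have -> : ((m + d)%N == m) = false by lia.
  have -> : ((m + d)%N \in B) = false by apply/negP => /gB; lia.
  by rewrite orbF; apply/eqP/eqP; lia.
rewrite [LHS](IH m') //; last by lia.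
apply: eq_big_seq => a aB; rewrite [in RHS]inE.
have am : (m' <= a)%N by move: aB; rewrite inE => /predU1P[->|/gB]; lia.
by have -> : ((a + d)%N == m) = false by lia.
Qed.

(** * Summation over the edges *)

Lemma sum_shift (V : zmodType) (f : nat -> V) N :
  \sum_(0 <= m < N) f m.+1 = \sum_(0 <= m < N) f m + f N - f 0%N.
Proof.
by rewrite -(big_nat_recr N 0%N f) // big_nat_recl // addrC addKr.
Qed.

Section LocalSum.
Variables (R : realFieldType) (theta : nat -> nat -> R) (N : nat) (x : nat -> bool).
Hypothesis thC : forall a b, theta a b = theta b a.
Hypothesis x_dom : forall m, x m -> (2 < m < N.+4)%N.
Hypothesis x_gap : forall m, x m -> ~~ x m.+1.

(** The value given by [count_incident] and [count_pivots] for [N.+4] triangles. *)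
Definition chain_deg (k : nat) : nat :=
  ((k < 2) + (0 < k <= N.+4) + 2 * (1 < k <= N.+4.+1)
   + ((k < N.+4)%N && ~~ x k + (k.+1 < N.+4)%N && x k.+1))%N.

Definition inner_deg k : nat := if x k then 3 else if x k.+1 then 5 else 4.

Lemma chain_deg_inner k : (1 < k < N.+4)%N -> chain_deg k = inner_deg k.
Proof.
move=> kn; rewrite /chain_deg /inner_deg.
have xk := x_gap (m := k); have xd := x_dom (m := k.+1).
case: (x k) (x k.+1) xk xd => [] [] xk xd; lia.
Qed.

Lemma pivot_deg m : (1 < m)%N ->
  inner_deg (m - x m) = if x m || x m.+1 then 5%N else 4%N.
Proof.
case: m => // m _; rewrite /inner_deg; case xm: (x m.+1) => /=; last by rewrite subn0 xm.
rewrite subn1 /= xm; case xm1: (x m) => //.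
by have := x_gap xm1; rewrite xm.
Qed.

(** The weight depends on four consecutive values of [x], no two neighbours being both true. So only
    products at distance 2 or 3 join the linear terms, with coefficients found by inclusion and
    exclusion. *)
Lemma inner_edges m : (1 < m)%N ->
  theta (inner_deg m.+1) (inner_deg m.+2) + theta (inner_deg (m - x m)) (inner_deg m.+2) =
  2%:R * theta 4 4 + (x m)%:R * (theta 4 5 - theta 4 4)
  + (x m.+1)%:R * (theta 3 4 + theta 4 5 - 2%:R * theta 4 4)
  + (x m.+2)%:R * (theta 3 5 + theta 3 4 - 2%:R * theta 4 4)
  + (x m.+3)%:R * (2%:R * theta 4 5 - 2%:R * theta 4 4)
  + (x m && x m.+2)%:R * (theta 3 5 - theta 4 5 - theta 3 4 + theta 4 4)
  + (x m.+1 && x m.+3)%:R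
      * (theta 3 5 - theta 3 4 - 3%:R * theta 4 5 + 2%:R * theta 4 4 + theta 5 5)
  + (x m && x m.+3)%:R * (theta 5 5 - 2%:R * theta 4 5 + theta 4 4).
Proof.
move=> m1; rewrite pivot_deg // /inner_deg.
have g1 := x_gap (m := m); have g2 := x_gap (m := m.+1); have g3 := x_gap (m := m.+2).
case: (x m) (x m.+1) (x m.+2) (x m.+3) g1 g2 g3 => [] [] [] [] g1 g2 g3.
all: try (by have := g1 isT); try (by have := g2 isT); try (by have := g3 isT).
all: rewrite /= ?(thC 5 4) ?(thC 5 3) ?(thC 4 3).
all: ring.
Qed.

Lemma TI_bends :
  theta (chain_deg 0) (chain_deg 1)
  + \sum_(0 <= m < N.+4) (theta (chain_deg m.+1) (chain_deg m.+2)
                          + theta (chain_deg (m - x m)) (chain_deg m.+2)) =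
  Lambda0 theta N.+4 + Lambda1 theta * ((x 3)%:R + (x N.+3)%:R)
  + Lambda2 theta * ((x 4)%:R + (x N.+2)%:R)
  + (1 + \sum_(0 <= m < N.+4) (x m)%:R) * Lambda3 theta
  + Lambda4 theta * (\sum_(0 <= m < N.+4) (x m && x m.+2)%:R)
  + Lambda5 theta * (\sum_(0 <= m < N.+4) (x m && x m.+3)%:R).
Proof.
have x0 : x 0 = false by apply/negP => /x_dom; lia.
have x1 : x 1 = false by apply/negP => /x_dom; lia.
have x2 : x 2 = false by apply/negP => /x_dom; lia.
have xt k : x (k + N.+4) = false by apply/negP => /x_dom; lia.
have xt0 : x N.+4 = false := xt 0%N.
have xt1 : x N.+4.+1 = false := xt 1%N.
have xt2 : x N.+4.+2 = false := xt 2%N.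
(* The first two and the last two triangles are set apart because they meet the degrees at the
   ends. *)
have split4 (f : nat -> R) : \sum_(0 <= m < N.+4) f m =
    f 0%N + f 1%N + (\sum_(0 <= m < N) f m.+2 + f N.+2 + f N.+3).
  by rewrite big_nat_recl // big_nat_recl // big_nat_recr //= big_nat_recr //= addrA.
rewrite !split4 x0 x1 xt0 xt1 xt2 !andbF /= !subn0.
have mid : \sum_(0 <= m < N) (theta (chain_deg m.+3) (chain_deg m.+4)
      + theta (chain_deg (m.+2 - x m.+2)) (chain_deg m.+4)) =
    \sum_(0 <= m < N) (theta (inner_deg m.+3) (inner_deg m.+4)
      + theta (inner_deg (m.+2 - x m.+2)) (inner_deg m.+4)).
  apply: eq_big_nat => m mN; rewrite !chain_deg_inner //; try lia.
  have := x_dom (m := m.+2); case: (x m.+2) => [/(_ isT)|_]; lia.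
rewrite mid {mid} (eq_bigr _ (fun m _ => @inner_edges m.+2 isT)).
rewrite !big_split /= -!mulr_suml sumr_const_nat subn0.
(* Shifting reduces everything to three sums, [S1], [S2] and [S3] below, plus boundary terms. *)
rewrite (sum_shift (fun m => (x m.+4)%:R)) (sum_shift (fun m => (x m.+3)%:R)).
rewrite (sum_shift (fun m => (x m.+2)%:R)).
rewrite (sum_shift (fun m => (x m.+2 && x m.+4)%:R)).
rewrite x2 xt0 andbF /=.
have d0 : chain_deg 0 = 2%N by rewrite /chain_deg x0 x1.
have d1 : chain_deg 1 = 3%N by rewrite /chain_deg x1 x2.
have dn : chain_deg N.+4 = 3%N by rewrite /chain_deg; lia.
have dn1 : chain_deg N.+4.+1 = 2%N by rewrite /chain_deg; lia.
rewrite d0 d1 dn dn1.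
have e2 : chain_deg (N.+2 - x N.+2) = inner_deg (N.+2 - x N.+2).
  apply: chain_deg_inner; have := x_dom (m := N.+2); case: (x N.+2) => [/(_ isT)|_]; lia.
have e3 : chain_deg (N.+3 - x N.+3) = inner_deg (N.+3 - x N.+3).
  apply: chain_deg_inner; have := x_dom (m := N.+3); case: (x N.+3) => [/(_ isT)|_]; lia.
rewrite e2 e3 !pivot_deg // !chain_deg_inner; try lia.
rewrite /inner_deg x2 xt0.
have g1 := x_gap (m := 3); have g2 := x_gap (m := N.+2).
move: (\sum_(0 <= m < N) (x m.+2)%:R) (\sum_(0 <= m < N) (x m.+2 && x m.+4)%:R)
  (\sum_(0 <= m < N) (x m.+2 && x m.+4.+1)%:R) => S1 S2 S3.
rewrite /Lambda0 /Lambda1 /Lambda2 /Lambda3 /Lambda4 /Lambda5.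
have -> : (2 * N.+4)%N%:R = 8%:R + 2%:R * N%:R :> R.
  by rewrite -natrM -natrD; congr (_%:R); lia.
rewrite -mulr_natr.
(* The remaining boundary indicators are treated as independent at the two ends, although they can
   coincide for small [N]. *)
case: (x 3) (x 4) g1 => [] [] g1; try (by have := g1 isT).
all: case: (x N.+2) (x N.+3) g2 => [] [] g2; try (by have := g2 isT).
all: rewrite /= ?(thC 5 4) ?(thC 5 3) ?(thC 4 3) ?(thC 5 2) ?(thC 4 2) ?(thC 3 2).
all: ring.
Qed.

End LocalSum.

(** * From bends to the length vector and the formula *)

Definition bends (T : seq tri) : seq nat := [seq m <- iota 0 (size T) | bend T m].

Lemma mem_bends T m : (m \in bends T) = bend T m.
Proof.
rewrite mem_filter mem_iota /= add0n andb_idr // => /and3P[_ + _].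
exact.
Qed.

Lemma bends_sorted T : tri_chain T -> max_deg_le 5 T -> sorted gap2 (bends T).
Proof.
move=> tc mx; apply: (@sub_in_sorted _ (bend T) ltn).
- move=> a b xa xb ab; rewrite /gap2 ltn_neqAle (ab : (a < b)%N) andbT.
  by apply: contraTneq xb => <-; apply: max_deg5_bend.
- exact: filter_all.
by apply: sorted_filter; [apply: ltn_trans | apply: iota_ltn_sorted].
Qed.

Lemma length_vector_bends T lv : tri_chain T -> max_deg_le 5 T -> length_vector T lv ->
  lv = lengths 0 (bends T) (size T).
Proof.
move=> tc mx [segs [srt segP ->]]; congr map.
have n0 : (0 < size T)%N by case: tc.
have bd m : m \in bends T -> (0 + 3 <= m < size T)%N.
  by rewrite mem_bends => /and3P[-> ->].
apply: (@irr_sorted_eq _ (relpre fst ltn)).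
- by move=> ? ? ?; apply: ltn_trans.
- by move=> ?; apply: ltnn.
- by rewrite -sorted_map.
- rewrite -sorted_map; apply: segments_of_sorted; first exact: bends_sorted.
  by move=> m /bd /andP[].
move=> [i j]; apply/idP/idP.
  move/segP/(is_segmentP _ _ tc (mem_bends T)) => h.
  exact/(segments_ofP _ _ n0 (bends_sorted tc mx) bd).
move/(segments_ofP _ _ n0 (bends_sorted tc mx) bd) => h.
exact/segP/(is_segmentP _ _ tc (mem_bends T)).
Qed.

Lemma TI_chain (R : realFieldType) (theta : nat -> nat -> R) (T : seq tri) (N : nat) :
  (forall a b, theta a b = theta b a) ->
  size T = N.+4 -> tri_chain T -> max_deg_le 5 T ->
  let x := bend T in
  TI theta T = Lambda0 theta N.+4 + Lambda1 theta * ((x 3)%:R + (x N.+3)%:R)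
    + Lambda2 theta * ((x 4)%:R + (x N.+2)%:R)
    + (1 + \sum_(0 <= m < N.+4) (x m)%:R) * Lambda3 theta
    + Lambda4 theta * (\sum_(0 <= m < N.+4) (x m && x m.+2)%:R)
    + Lambda5 theta * (\sum_(0 <= m < N.+4) (x m && x m.+3)%:R).
Proof.
move=> thC sT tc mx x.
have x_dom m : x m -> (2 < m < N.+4)%N by rewrite -sT => /and3P[-> ->].
have x_gap m : x m -> ~~ x m.+1 by apply: max_deg5_bend.
have [|v [p lab]] := labels_exist tc; first by rewrite sT.
have pP := lab.2.
(* As no two bends are adjacent, a kept pivot is [p m.-1 = m.-1]: it lags by exactly one. *)
have px m : (m < N.+4)%N -> p m = (m - x m)%N.
  move=> mn; have xE k : (k < N.+4)%N -> x k = (p k != k).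
    by rewrite -sT; apply: (bend_labels tc lab).
  case xm: (x m); last by rewrite subn0; apply/eqP; rewrite -[_ == _]negbK -xE ?xm.
  have := xE m mn; rewrite xm => /esym /(pivot_kept pP)[m2 ->].
  rewrite subn1; apply/eqP; rewrite -[_ == _]negbK -xE; last by lia.
  apply/negP => /x_gap; have -> : m.-1.+1 = m by lia.
  by rewrite xm.
rewrite -(TI_bends thC x_dom x_gap) (TI_labels tc lab thC) sT.
have dE k : count (incident k) (label_pairs p N.+4) = chain_deg N x k.
  rewrite (count_incident pP) (count_pivots (x := x)) // => m /x_dom.
  by case/andP.
rewrite !dE; congr (_ + _); apply: eq_big_nat => m /andP[_ mn].
by rewrite !dE px.
Qed.

Lemma sum_bends (R : pzSemiRingType) T d :
  \sum_(a <- bends T) ((a + d)%N \in bends T)%:R =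
  \sum_(0 <= m < size T) (bend T m && bend T (m + d))%:R :> R.
Proof.
rewrite big_filter big_mkcond /= /index_iota subn0; apply: eq_bigr => m _.
by rewrite mem_bends; case: (bend T m).
Qed.

Theorem theorem2p1 (R : realFieldType) (theta : nat -> nat -> R) (n : nat)
    (T : seq tri) (lv : seq nat) :
  (forall a b, theta a b = theta b a) ->
  (forall a b, 0 <= theta a b) ->
  (4 <= n)%N -> size T = n -> tri_chain T -> max_deg_le 5 T ->
  length_vector T lv ->
  let s := size lv in
  [/\ s = 1%N ->
        TI theta T = Lambda0 theta n + Lambda3 theta,
      s = 2%N ->
        TI theta T = Lambda0 theta n
          + Lambda1 theta * (eta_ R lv 0 + eta_ R lv 1)
          + Lambda2 theta * (xi_ R lv 0 + xi_ R lv 1) + 2%:R * Lambda3 theta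
    & (3 <= s)%N ->
        TI theta T = Lambda0 theta n
          + Lambda1 theta * (eta_ R lv 0 + eta_ R lv s.-1)
          + Lambda2 theta * (xi_ R lv 0 + xi_ R lv s.-1) + s%:R * Lambda3 theta
          + Lambda4 theta * (\sum_(1 <= k < s.-1) xi_ R lv k)
          + Lambda5 theta * (\sum_(1 <= k < s.-1) sigma_ R lv k)].
Proof.
move=> thC _ n4 sT tc mx lvP s; have [N nE] : exists N, n = N.+4 by exists (n - 4)%N; lia.
rewrite nE in sT *; move=> {n4 nE n}.
have x_dom m : bend T m -> (2 < m < N.+4)%N by rewrite -sT => /and3P[-> ->].
have x_gap m : bend T m -> ~~ bend T m.+1 by apply: max_deg5_bend.
have lvE := length_vector_bends tc mx lvP; rewrite sT in lvE.
have sE : s = (size (bends T)).+1 by rewrite /s lvE size_lengths.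
have S1 : \sum_(0 <= m < N.+4) (bend T m)%:R = (size (bends T))%:R :> R.
  rewrite size_filter -sum1_count natr_sum [RHS]big_mkcond sT /index_iota subn0.
  by apply: eq_bigr => m _; case: (bend T m).
have tie := TI_chain thC sT tc mx; rewrite /= S1 in tie.
have srt := bends_sorted tc mx.
have [B0|[m [B BE]]] : bends T = [::] \/ exists m B, bends T = m :: B.
  by case: (bends T) => [|m B]; [left | right; exists m, B].
  have x0 m : bend T m = false by rewrite -mem_bends B0.
  rewrite sE B0; split=> // _; rewrite tie B0 !x0 /=.
  rewrite (eq_bigr (fun=> 0)) => [|m _]; last by rewrite x0.
  rewrite [X in Lambda5 _ * X](eq_bigr (fun=> 0)) => [|m _]; last by rewrite x0.
  by rewrite !big1_eq; ring.
have bP k : k \in m :: B -> (2 < k < N.+4)%N by rewrite -BE mem_bends => /x_dom.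
have pth : path gap2 m B by rewrite -/(sorted gap2 (m :: B)) -BE.
have m2 : (2 < m)%N by have := bP m (mem_head _ _); lia.
(* The first segment stops just before the first bend, so its length is [m]. *)
have lvE' : lv = m :: lengths (m - 2) B N.+4.
  by rewrite lvE BE /lengths /=; congr (_ :: _); lia.
have sB : s = (size B).+2 by rewrite sE BE.
have mmin k : bend T k -> (m <= k)%N.
  rewrite -mem_bends BE inE => /predU1P[->//|kB].
  by have := order_path_min gap2_trans pth => /allP /(_ _ kB); rewrite /gap2; lia.
have bm : bend T m by rewrite -mem_bends BE mem_head.
have bl : bend T (last m B) by rewrite -mem_bends BE mem_last.
have lmax k : bend T k -> (k <= last m B)%N.
  rewrite -mem_bends BE; elim: (B) (m) k pth {bP lvE' BE bl mmin m2 sB bm} => [|m' B' IH] a k /=.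
    by move=> _; rewrite inE => /eqP ->.
  move=> /andP[am' pth']; rewrite inE => /predU1P[->|]; last exact: IH.
  apply: leq_trans (IH m' m' pth' (mem_head _ _)); move: am'; rewrite /gap2; lia.
have eta0 : eta_ R lv 0 = (bend T 3)%:R.
  rewrite /eta_ lvE' /=; congr (nat_of_bool _)%:R; apply/eqP/idP => [<- //|/mmin]; lia.
(* A bend at 4 must be the first one, since a bend at 3 would be adjacent to it. *)
have xi0 : xi_ R lv 0 = (bend T 4)%:R.
  rewrite /xi_ lvE' /=; congr (nat_of_bool _)%:R; apply/eqP/idP => [<- //|b4].
  have := mmin _ b4; have := x_gap m bm; case: (ltngtP m 3) => [||->]; rewrite ?b4 //; lia.
(* This is [N + 6] minus the last bend: the lengths 3 and 4 mean a last bend at [N.+3] and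
   [N.+2]. *)
have lst : nth 0%N lv s.-1 = (N.+3 - (last m B - 2)).+1.
  by rewrite sB lvE' /= last_length.
have ld := x_dom _ bl.
have etas : eta_ R lv s.-1 = (bend T N.+3)%:R.
  rewrite /eta_ lst; congr (nat_of_bool _)%:R; apply/eqP/idP => [le|/lmax]; last by lia.
  by have <- : last m B = N.+3 by lia.
have xis : xi_ R lv s.-1 = (bend T N.+2)%:R.
  rewrite /xi_ lst; congr (nat_of_bool _)%:R; apply/eqP/idP => [le|b4].
    by have <- : last m B = N.+2 by lia.
  have := lmax _ b4; have := x_gap _ b4.
  by case: (eqVneq (last m B) N.+3) => [<-|]; rewrite ?bl //; lia.
(* Interior lengths 4 and 5 correspond to bends at distance 2 and 3. *)
have S2 : \sum_(1 <= k < s.-1) xi_ R lv k = \sum_(0 <= m < N.+4) (bend T m && bend T m.+2)%:R.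
  rewrite sB /= big_add1 /= lvE' (sum_lengths R _ pth m2 (d := 2)) // -BE sum_bends sT.
  by apply: eq_bigr => k _; rewrite addn2.
have S3 : \sum_(1 <= k < s.-1) sigma_ R lv k = \sum_(0 <= m < N.+4) (bend T m && bend T m.+3)%:R.
  rewrite sB /= big_add1 /= lvE' (sum_lengths R _ pth m2 (d := 3)) // -BE sum_bends sT.
  by apply: eq_bigr => k _; rewrite addn3.
have tie' : TI theta T = Lambda0 theta N.+4
    + Lambda1 theta * (eta_ R lv 0 + eta_ R lv s.-1)
    + Lambda2 theta * (xi_ R lv 0 + xi_ R lv s.-1) + s%:R * Lambda3 theta
    + Lambda4 theta * (\sum_(1 <= k < s.-1) xi_ R lv k)
    + Lambda5 theta * (\sum_(1 <= k < s.-1) sigma_ R lv k).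
  by rewrite eta0 xi0 etas xis S2 S3 tie sE nat1r.
split=> // [|s2]; first by rewrite sB.
by rewrite tie' s2 /= !big_geq // !mulr0 !addr0.
Qed.
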